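(* Let $R$ be a finite local commutative ring, $K\le R^\times$ a pure group, $\mathcal C=\mathrm{Cyc}(K,R)$, $I_0=\{x\in\mathrm{rad}(R):\ x\,\mathrm{rad}(R)=\{0\}\}$, $\pi_0:R\to R/I_0$ the natural epimorphism, and $\mathcal C'=\mathrm{Cyc}(\pi_0(K),R/I_0)$. Then $\mathcal C$ is normal whenever $\mathcal C'$ is normal.
   Context: All rings have an identity. For a finite local commutative ring $R$, $\mathrm{rad}(R)$ is its unique maximal ideal. For a subgroup $K$ of $R^\times$, the cyclotomic scheme $\mathrm{Cyc}(K,R)$ is the pair $(R,\mathrm{Rel}(K,R))$, where $\mathrm{Rel}(K,R)$ is the set of binary relations $\{(x,y)\in R\times R:\ y-x\in rK\}$, $r\in R$. Its automorphism group $\mathrm{Aut}(\mathcal C)$ is the group of permutations $f$ of $R$ with $S^f=S$ for all $S\in\mathrm{Rel}(K,R)$. $\mathrm{A\Gamma L}_1(R)$ is the group of permutations $x\mapsto ax^\sigma+b$ with $a\in R^\times$, $b\in R$, $\sigma\in\mathrm{Aut}(R)$; the scheme is normal if $\mathrm{Aut}(\mathcal C)\le\mathrm{A\Gamma L}_1(R)$. A group $K\le R^\times$ is pure if the only ideal $I$ of $R$ with $1+I\subseteq K$ is $I=\{0\}$. Note $\pi_0(K)\le (R/I_0)^\times$. *)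

(* Defs.v *)
From HB Require Import structures.
From mathcomp Require Import all_boot all_order all_algebra all_fingroup.
Set Implicit Arguments. Unset Strict Implicit. Unset Printing Implicit Defensive.
Import GRing.Theory.
Local Open Scope ring_scope.

Definition is_ideal (R : finComUnitRingType) (I : {set R}) : Prop :=
  0 \in I /\ (forall x y, x \in I -> y \in I -> x + y \in I) /\
  (forall r x, x \in I -> r * x \in I).

Definition is_maximal_ideal (R : finComUnitRingType) (M : {set R}) : Prop :=
  is_ideal M /\ M != [set: R] /\
  (forall N : {set R}, is_ideal N -> M \subset N -> N = M \/ N = [set: R]).

Definition local_with_rad (R : finComUnitRingType) (M : {set R}) : Prop :=
  is_maximal_ideal M /\ (forall N, is_maximal_ideal N -> N = M).

Definition unit_elems (R : finComUnitRingType) (K : {group {unit R}}) : {set R} :=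
  [set val k | k in K].

Definition pure (R : finComUnitRingType) (K : {group {unit R}}) : Prop :=
  forall I : {set R}, is_ideal I ->
    (forall x, x \in I -> 1 + x \in unit_elems K) -> I = [set 0].

Definition cyc_rel (R : finComUnitRingType) (K : {set R}) (r : R) : rel R :=
  fun x y => [exists k in K, y - x == r * k].

Definition cyc_aut (R : finComUnitRingType) (K : {set R}) (f : {perm R}) : Prop :=
  forall r x y, cyc_rel K r (f x) (f y) = cyc_rel K r x y.

Definition ring_aut (R : finComUnitRingType) (s : R -> R) : Prop :=
  [/\ bijective s, s 1 = 1, (forall x y, s (x + y) = s x + s y) &
      (forall x y, s (x * y) = s x * s y)].

Definition in_AGammaL1 (R : finComUnitRingType) (f : R -> R) : Prop :=
  exists (a b : R) (s : R -> R),
    [/\ a \is a GRing.unit, ring_aut s & forall x, f x = a * s x + b].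

Definition cyc_normal (R : finComUnitRingType) (K : {set R}) : Prop :=
  forall f : {perm R}, cyc_aut K f -> in_AGammaL1 f.

(* Main.v *)
(* Let V = I_0, F = R/rad(R), so that V is an F-space, and A = {a in V : 1 + a in K},
   an additive subgroup that contains no F-line because K is pure. An automorphism f of
   the scheme, normalized by f(0) = 0 and f(1) = 1, induces a ring automorphism of R/V.
   If two normalized automorphisms agree modulo V, then their "difference" delta : R -> V
   factors through F and has all its difference quotients in A, which forces delta to be
   affine, hence zero. Comparing f with x |-> f(rx)/f(r) gives multiplicativity; comparing
   it with x |-> (f(x+r) - f(r))/(f(1+r) - f(r)) gives f(x+r) = f(r) + (1 + a_r) f(x) with
   a_x = a_1 f(x), so that R a_1 lies in A and a_1 = 0.
   That delta : F -> V is affine: by induction on the degree of delta as a polynomial with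
   coefficients in V, the differences delta(x+t) - delta(x) are affine, and their slope
   spans a line in tA, so delta - delta(0) is additive. An additive delta is a
   p-polynomial sum_i v_i x^(p^i); summing delta(u)/u with the weights
   -Tr(c u^(1-p^k)), which lie in the prime field, isolates c v_k, so v_k = 0 for k > 0. *)
Require Import Defs.
From HB Require Import structures.
From mathcomp Require Import all_boot all_order all_algebra all_fingroup.
From mathcomp Require Import all_solvable all_field zify ring.
Import GRing.Theory.
Local Open Scope ring_scope.
Set Implicit Arguments. Unset Strict Implicit. Unset Printing Implicit Defensive.

(** * Residue field and annihilator module *)

(** Elements outside [M] are units, so the inverse of a nonzero class is the class of the inverse of
    a representative. *)
Lemma residue_field (R : finComUnitRingType) (M : {set R}) :
  is_ideal M -> (forall x, x \notin M -> x \is a GRing.unit) -> 1 \notin M ->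
  exists (F : finFieldType) (p : {rmorphism R -> F}),
    (forall y, exists x, p x = y) /\ (forall x, (p x == 0) = (x \in M)).
Proof.
move=> [M0 [MD MM]] MU M1.
have Mid : idealr_closed (mem M).
  by split=> // a u v uM vM; apply: MD => //; apply: MM.
pose I : idealr R := HB.pack (fun x => x \in M) (isIdealr.Build R (fun x => x \in M) Mid).
pose Q : comNzRingType := {ideal_quot I}.
pose p : {rmorphism R -> Q} := \pi_({ideal_quot I})%qT.
have p0 x : (p x == 0) = (x \in M).
  rewrite -(rmorph0 p) /p -Quotient.idealrBE subr0. by [].
pose s (y : Q) : R := generic_quotient.repr (y : {ideal_quot I}).
have sK : cancel s p by move=> y; apply: reprK.
pose inv (y : Q) : Q := if y == 0 then 0 else p (s y)^-1.
have mulVq (y : Q) : y != 0 -> inv y * y = 1.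
  move=> y0; rewrite /inv (negPf y0) -[in X in _ * X](sK y) -rmorphM mulVr ?rmorph1 //.
  by apply: MU; rewrite -p0 sK.
have inv0 : inv 0 = 0 by rewrite /inv eqxx.
pose Qf : fieldType := HB.pack (GRing.ComNzRing.sort Q)
  (GRing.ComNzRing_isField.Build Q mulVq inv0).
pose F : finFieldType := HB.pack (GRing.Field.sort Qf) (GRing.Field.class Qf)
  (PCanIsCountable (can_pcan sK)) (CanIsFinite sK).
exists F, (p : {rmorphism R -> F}); split=> [y|x]; last exact: p0.
by exists (s y); apply: sK.
Qed.

(** The kernel of [p] acts by zero on its own annihilator, so multiplication by [R] there factors
    through [F]. *)
Lemma annihilator_module (R : finComUnitRingType) (F : fieldType) (p : {rmorphism R -> F}) :
  (forall y, exists x, p x = y) ->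
  exists (V : lmodType F) (i : {additive V -> R}), [/\ injective i,
    forall r v, i (p r *: v) = r * i v &
    forall x, (forall m, p m = 0 -> x * m = 0) -> exists v, i v = x].
Proof.
move=> psurj.
pose P := [pred x : R | [forall m, (p m == 0) ==> (x * m == 0)]].
have PE x : reflect (forall m, p m = 0 -> x * m = 0) (x \in P).
  apply: (iffP forallP) => h m; first by move=> m0; apply/eqP/(implyP (h m))/eqP.
  by apply/implyP=> /eqP /h ->.
have Pcl : zmod_closed P.
  split=> [|x y /PE hx /PE hy]; apply/PE => m m0; first by rewrite mul0r.
  by rewrite mulrBl hx // hy // subrr.
pose U : subZmodType P := HB.pack {x | P x} (GRing.SubChoice_isSubZmodule.Build R P {x | P x} Pcl).
have [l lK] : exists l : F -> R, cancel l p.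
  have h y : [exists x, p x == y] by have [x <-] := psurj y; apply/existsP; exists x.
  by exists (fun y => xchoose (existsP (h y))) => y; apply/eqP/(xchooseP (existsP (h y))).
(* Ring elements with equal residues act alike; this yields the module axioms although the lift [l]
   need not respect any operation. *)
have lE a b (v : U) : p a = p b -> a * val v = b * val v.
  move=> ab; apply/eqP; rewrite -subr_eq0 -mulrBl mulrC.
  by have /PE h := valP v; rewrite h // rmorphB ab subrr.
have sP a (v : U) : l a * val v \in P.
  by apply/PE=> m m0; have /PE h := valP v; rewrite -mulrA h ?mulr0.
pose sc a (v : U) : U := Sub (l a * val v) (sP a v).
have scE a v : val (sc a v) = l a * val v by apply: SubK.
have vD : {morph (val : U -> R) : v w / v + w} by apply: raddfD.
have scA a b v : sc a (sc b v) = sc (a * b) v.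
  by apply: val_inj; rewrite !scE mulrA; apply: lE; rewrite rmorphM !lK.
have sc1 : left_id 1 sc.
  by move=> v; apply: val_inj; rewrite !scE -[RHS]mul1r; apply: lE; rewrite rmorph1 !lK.
have scDr : right_distributive sc +%R.
  by move=> a v w; apply: val_inj; rewrite vD !scE vD mulrDr.
have scDl v : {morph sc^~ v : a b / a + b}.
  by move=> a b; apply: val_inj; rewrite vD !scE -mulrDl; apply: lE; rewrite rmorphD !lK.
pose V : lmodType F := HB.pack (GRing.SubZmodule.sort U)
  (GRing.Zmodule_isLmodule.Build F U scA sc1 scDr scDl).
exists V, (val : {additive U -> R}); split.
- exact: val_inj.
- by move=> r v; rewrite -(lE (l (p r)) r v) ?lK //; apply: scE.
- by move=> x /PE xP; exists (Sub x xP : U); apply: SubK.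
Qed.

(** * Functions on a finite field with values in a vector space *)

Section FinFieldSums.

Variable F : finFieldType.
Local Notation N := (#|F|.-1).

Lemma expf_card_pred (x : F) : x != 0 -> x ^+ N = 1.
Proof.
move=> x0; apply: (mulfI x0); rewrite mulr1 -exprS prednK ?expf_card //.
exact: ltnW (finNzRing_gt1 F).
Qed.

Lemma expf_mod (x : F) a : x != 0 -> x ^+ (a %% N) = x ^+ a.
Proof.
move=> x0; rewrite [in RHS](divn_eq a N) exprD mulnC exprM expf_card_pred //.
by rewrite expr1n mul1r.
Qed.

(** [X^d - 1] has at most [d] roots, fewer than there are nonzero elements. *)
Lemma exists_expf_neq1 d : (0 < d < N)%N -> exists2 w : F, w != 0 & w ^+ d != 1.
Proof.
case/andP=> d0 dN; apply/exists_inP; apply: contraLR dN; rewrite negb_exists_in -leqNgt.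
move/forall_inP=> h.
have p0 : 'X^d - 1 != 0 :> {poly F} by rewrite -size_poly_eq0 size_XnsubC.
have := max_poly_roots (rs := enum (predC1 (0 : F))) p0.
rewrite size_XnsubC // -cardE cardC1 ltnS; apply; last exact: enum_uniq.
apply/allP=> w; rewrite mem_enum => w0; rewrite rootE !hornerE subr_eq0.
by have /negPn := h w w0.
Qed.

(** Substituting [w * u] for [u] multiplies the sum by [w ^+ a / w ^+ b], which differs from 1 for a
    suitable [w]. *)
Lemma sum_expf_eq0 a b : a != b %[mod N] ->
  \sum_(u : F | u != 0) u ^+ a / u ^+ b = 0.
Proof.
move=> ab.
have [w w0 wab] : exists2 w : F, w != 0 & w ^+ a != w ^+ b.
  wlog lab : a b ab / (a %% N < b %% N)%N.
    move=> h; case: (ltngtP (a %% N) (b %% N)) => [lab|lba|e].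
    - exact: h ab lab.
    - by rewrite eq_sym in ab; have [w w0 ww] := h _ _ ab lba; exists w; rewrite // eq_sym.
    - by rewrite e eqxx in ab.
  have N0 : (0 < N)%N by have := finNzRing_gt1 F; case: #|F| => [|[]].
  have [|w w0 wd] := @exists_expf_neq1 (b %% N - a %% N).
    by rewrite subn_gt0 lab (leq_ltn_trans (leq_subr _ _)) ?ltn_mod.
  exists w => //; apply: contra wd => /eqP e.
  have e' : w ^+ (b %% N) = w ^+ (a %% N) by rewrite !expf_mod.
  rewrite -(inj_eq (mulfI (expf_neq0 (a %% N) w0))) mulr1 -exprD subnKC ?e' //.
  exact: ltnW.
set s := \sum_(_ | _) _; have : s = (w ^+ a / w ^+ b) * s.
  rewrite {1}/s (reindex_onto (fun u => w * u) (fun u => w^-1 * u)) /=; last first.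
    by move=> u _; rewrite mulVKf.
  rewrite mulr_sumr; apply: eq_big => u; first by rewrite mulf_eq0 negb_or w0 mulKf ?eqxx ?andbT.
  by move=> _; rewrite !exprMn invfM mulrACA.
move/eqP; rewrite -subr_eq0 -{1}[s]mul1r -mulrBl mulf_eq0 subr_eq0 => /orP[|/eqP//].
by rewrite eq_sym (can2_eq (divfK _) (mulfK _)) ?expf_neq0 // mul1r (negPf wab).
Qed.

Lemma card_finField_natr : #|F|%:R = 0 :> F.
Proof.
have := cyclic.expg_cardG (in_setT (1 : F)).
by rewrite FinRing.zmodXgE cardsT FinRing.zmod1gE.
Qed.

Lemma sum_nz_1 : \sum_(u : F | u != 0) 1 = -1 :> F.
Proof.
rewrite sumr_const cardC1; apply/eqP; rewrite -subr_eq0 opprK -mulrSr prednK.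
  by rewrite card_finField_natr.
exact: ltnW (finNzRing_gt1 F).
Qed.

End FinFieldSums.

(** * Vector-valued polynomial functions and their coefficients *)

Section PolynomialFunctions.

Variables (F : finFieldType) (V : lmodType F).
Local Notation N := (#|F|.-1).

(* [d] bounds the number of coefficients: the degree is less than [d]. *)
Definition polyfun d (f : F -> V) :=
  exists v : nat -> V, forall x, f x = \sum_(i < d) x ^+ i *: v i.

Lemma polyfun_ext d f g : f =1 g -> polyfun d f -> polyfun d g.
Proof. by move=> fg [v fv]; exists v => x; rewrite -fg. Qed.

Lemma polyfun_horner d (p : {poly F}) v :
  (size p <= d)%N -> polyfun d (fun x => p.[x] *: v).
Proof.
move=> pd; exists (fun i => p`_i *: v) => x.
rewrite (horner_coef_wide _ pd) scaler_suml.
by apply: eq_bigr => i _; rewrite scalerA mulrC.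
Qed.

Lemma polyfun_sum d (I : finType) (f : I -> F -> V) :
  (forall i, polyfun d (f i)) -> polyfun d (fun x => \sum_i f i x).
Proof.
move=> fP; have [v fv] := fin_all_exists fP; exists (fun j => \sum_i v i j) => x.
under eq_bigr do rewrite fv.
by rewrite exchange_big; apply: eq_bigr => j _; rewrite scaler_sumr.
Qed.

(** Interpolation: [1 - (x - z) ^+ N] is 1 at [x = z] and 0 elsewhere. *)
Lemma polyfun_card (f : F -> V) : polyfun #|F| f.
Proof.
have F1 := finNzRing_gt1 F.
apply: (@polyfun_ext _ (fun x => \sum_z (1 - ('X - z%:P) ^+ N).[x] *: f z)) => [x|].
  rewrite (bigD1 x) //= big1 => [|z zx].
    have N0 : (N == 0)%N = false by rewrite -subn1 subn_eq0 leqNgt F1.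
    by rewrite !hornerE subrr expr0n N0 oppr0 addr0 scale1r ?addr0.
  by rewrite !hornerE expf_card_pred ?subrr ?scale0r // subr_eq0 eq_sym.
apply: (@polyfun_sum _ _ (fun z x => (1 - ('X - z%:P) ^+ N).[x] *: f z)) => z.
apply: polyfun_horner.
rewrite (leq_trans (size_polyD _ _)) // size_polyN geq_max size_poly1 (ltnW F1).
by rewrite size_exp_XsubC prednK ?leqnn ?(ltnW F1).
Qed.

Lemma size_shift_exp (t : F) i : (size (('X + t%:P) ^+ i - 'X^i : {poly F})%R <= i)%N.
Proof.
rewrite exprDn big_ord_recl /= subn0 expr0 mulr1 bin0 mulr1n addrAC subrr add0r.
apply: leq_trans (size_sum _ _ _) _; apply/bigmax_leqP => j _.
rewrite -polyC_exp mulrC mul_polyC scalerMnl.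
rewrite (leq_trans (size_scale_leq _ _)) // size_polyXn.
by rewrite /bump /= add1n subnSK // leq_subr.
Qed.

(** Differencing lowers the degree, as the top terms of [(x + t) ^+ i] and [x ^+ i] cancel. *)
Lemma polyfun_shift d (f : F -> V) t :
  polyfun d.+1 f -> polyfun d (fun x => f (x + t) - f x).
Proof.
case=> v fv.
apply: (@polyfun_ext _ (fun x => \sum_(i < d.+1) (('X + t%:P) ^+ i - 'X^i).[x] *: v i)).
  move=> x; rewrite !fv -sumrB; apply: eq_bigr => i _.
  by rewrite !hornerE scalerBl.
apply: (@polyfun_sum _ _
  (fun (i : 'I_d.+1) x => (('X + t%:P) ^+ i - 'X^i).[x] *: v i)) => i.
apply: polyfun_horner.
by rewrite (leq_trans (size_shift_exp _ _)) // -ltnS.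
Qed.

Lemma polyfun_inj (v : nat -> V) :
  (forall x, \sum_(i < #|F|) x ^+ i *: v i = 0) ->
  forall m, (m < #|F|)%N -> v m = 0.
Proof.
have F1 := finNzRing_gt1 F => v0.
have FN : #|F| = N.+1 by rewrite prednK // ltnW.
(* The constant term is read off at 0 first, since the exponents 0 and [N] agree on nonzero
   elements. *)
have z0 : v 0%N = 0.
  have := v0 0; rewrite FN big_ord_recl /= scale1r big1 ?addr0 // => i _.
  by rewrite exprS mul0r scale0r.
case=> // m mF.
(* Averaging against u^-m over the nonzero u isolates the coefficient of index m. *)
have : \sum_(u : F | u != 0) (u ^+ m.+1)^-1 *: \sum_(i < #|F|) u ^+ i *: v i = 0.
  by apply: big1 => u _; rewrite v0 scaler0.
under eq_bigr do rewrite scaler_sumr; rewrite exchange_big (bigD1 (Ordinal mF)) //=.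
rewrite [X in _ + X]big1 => [|[i iF] im]; last first.
  have [i0|i0] := eqVneq i 0%N; first by rewrite big1 // => u _ /=; rewrite i0 z0 !scaler0.
  under eq_bigr do rewrite scalerA mulrC; rewrite -scaler_suml sum_expf_eq0 ?scale0r //=.
  have {}im : i != m.+1 by [].
  move: i0 im mF iF; rewrite FN; move: (N) => n i0 im mF iF.
  have [im'|im'|e] := ltngtP i m.+1; last by rewrite e eqxx in im.
  - rewrite [X in X != _]modn_small ?(leq_trans im') //.
    have [->|mn] := eqVneq m.+1 n; first by rewrite modnn.
    by rewrite modn_small // ltn_neqAle mn.
  - rewrite [X in _ != X]modn_small; last exact: leq_trans im' _.
    have [->|mn] := eqVneq i n; first by rewrite modnn.
    by rewrite modn_small // ltn_neqAle mn.
rewrite addr0; under eq_bigr => u u0.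
  rewrite scalerA mulVf ?expf_neq0 //; over.
by rewrite -scaler_suml sum_nz_1 scaleN1r => /eqP; rewrite oppr_eq0 => /eqP.
Qed.

End PolynomialFunctions.

Lemma coef_XD1_exp (F : comNzRingType) m j : (('X + 1) ^+ m : {poly F})`_j = 'C(m, j)%:R.
Proof.
rewrite addrC exprDn coef_sum.
under eq_bigr do rewrite expr1n mul1r coefMn coefXn mulrb.
have [jm|jm] := ltnP j m.+1.
  rewrite (bigD1 (Ordinal jm)) //= eqxx big1 ?addr0 // => i ij.
  case: ifP => [/eqP e|_]; last by rewrite mul0rn.
  by rewrite -val_eqE /= -e eqxx in ij.
rewrite bin_small // big1 // => i _; case: ifP => [/eqP e|_]; last by rewrite mul0rn.
by have := ltn_ord i; rewrite -e ltnNge jm.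
Qed.

(** The coefficient of [X^(p^e)] in [(X + 1)^(p^e r) = (X^(p^e) + 1)^r] is that of [X] in
    [(X + 1)^r]. *)
Lemma bin_pchar_mul (F : fieldType) p e r : p \in [pchar F] ->
  'C(p ^ e * r, p ^ e)%:R = r%:R :> F.
Proof.
move=> cp; have p0 := prime_gt0 (pcharf_prime cp).
have pnat : [pchar {poly F}].-nat (p ^ e)%N.
  rewrite pnatX; apply/orP; left; rewrite (eq_pnat _ (pchar_lalg _)).
  by rewrite (eq_pnat _ (pcharf_eq cp)) pnat_id // (pcharf_prime cp).
rewrite -coef_XD1_exp exprM exprDn_pchar // expr1n.
have -> : ('X^(p ^ e) + 1) ^+ r = (('X + 1) ^+ r) \Po 'X^(p ^ e) :> {poly F}.
  by rewrite rmorphXn rmorphD rmorph1 /= comp_polyX.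
by rewrite coef_comp_poly_Xn ?expn_gt0 ?p0 // dvdnn divnn expn_gt0 p0 coef_XD1_exp bin1.
Qed.

(** * Additive functions as p-polynomials, and the trace *)

Section AdditiveFunctions.

Variables (F : finFieldType) (V : lmodType F) (p : nat).
Hypothesis cp : p \in [pchar F].
Local Notation N := (#|F|.-1).

(** This is the coefficient of [x^j t^k] in [f (x + t) - f x - f t]. Coefficients are compared first
    in [x], then in [t]; both degrees stay below [#|F|]. *)
Lemma additive_bin_coef (v : nat -> V) :
  {morph (fun x => \sum_(i < #|F|) x ^+ i *: v i) : x y / x + y} ->
  forall j k, (0 < j)%N -> (0 < k)%N -> (k + j < #|F|)%N ->
  'C(k + j, j)%:R *: v (k + j)%N = 0.
Proof.
move=> vD j k j0 k0 kjF.
have jF : (j < #|F|)%N by rewrite (leq_trans _ kjF) // ltnS leq_addl.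
have kF : (k < #|F|)%N by rewrite (leq_trans _ kjF) // ltnS leq_addr.
(* [w t i] is the coefficient of x^i in the shifted function at x + t. *)
pose w t i := \sum_(m < #|F|) ('C(m, i)%:R * t ^+ (m - i)) *: v m.
have w_shift x t : \sum_(i < #|F|) (x + t) ^+ i *: v i = \sum_(i < #|F|) x ^+ i *: w t i.
  under [RHS]eq_bigr do rewrite scaler_sumr.
  rewrite exchange_big; apply: eq_bigr => m _ /=.
  under eq_bigr do rewrite scalerA; rewrite -scaler_suml; congr (_ *: _).
  rewrite addrC exprDn (big_ord_widen _ (fun i => t ^+ (m - i) * x ^+ i *+ 'C(m, i)) (ltn_ord m)).
  rewrite big_mkcond; apply: eq_bigr => i _.
  case: ltnP => [_|mi]; last by rewrite bin_small ?mul0r ?mulr0.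
  by rewrite mulrCA mulr_natl mulrC -mulrnAl mulrC.
have wj t : w t j = v j.
  (* The coefficients in [x] of [f (x + t) - f x - f t]; [f t] enters only the constant one. *)
  pose u i := w t i - v i - (i == 0)%N%:R *: \sum_(i < #|F|) t ^+ i *: v i.
  have : u j = 0.
    apply: polyfun_inj (jF) => x; under eq_bigr do rewrite !scalerBr.
    rewrite !sumrB -w_shift vD; have F0 : (0 < #|F|)%N := ltn_trans j0 jF.
    rewrite [X in _ - X](bigD1 (Ordinal F0)) //= expr0 !scale1r.
    rewrite [X in _ - (_ + X)]big1 ?addr0 => [|i i0].
      by rewrite addrAC addrK subrr.
    by rewrite -val_eqE in i0; rewrite (negPf i0) scale0r scaler0.
  by rewrite /u eqn0Ngt j0 scale0r subr0 => /eqP; rewrite subr_eq0 => /eqP.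
(* The coefficients in [t] of [w t j - v j]. *)
pose u i := (if (i + j < #|F|)%N then 'C(i + j, j)%:R *: v (i + j)%N else 0) - (i == 0)%N%:R *: v j.
have : u k = 0.
  apply: polyfun_inj (kF) => t; under eq_bigr do rewrite scalerBr.
  have F0 : (0 < #|F|)%N := ltn_trans j0 jF.
  rewrite sumrB [X in _ - X](bigD1 (Ordinal F0)) //= expr0 !scale1r.
  rewrite [X in _ - (_ + X)]big1 ?addr0 => [|i i0]; last first.
    by rewrite -val_eqE in i0; rewrite (negPf i0) scale0r scaler0.
  rewrite -(wj t) /w; apply/eqP; rewrite subr_eq0; apply/eqP.
  rewrite [LHS](eq_bigr (fun i : 'I_#|F| => if (i + j < #|F|)%N
    then ('C(i + j, j)%:R * t ^+ (i + j - j)) *: v (i + j)%N else 0)); last first.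
    by move=> i _; case: ifP; rewrite ?scaler0 // addnK scalerA mulrC.
  rewrite -big_mkcond /=.
  pose f m := ('C(m, j)%:R * t ^+ (m - j)) *: v m.
  transitivity (\sum_(j <= m < #|F|) f m).
    rewrite -[X in index_iota X]add0n big_addn big_mkord.
    rewrite (big_ord_widen _ (fun i => f (i + j)%N) (leq_subr j _)).
    by apply: eq_bigl => i; rewrite ltn_subRL addnC.
  rewrite -(big_mkord xpredT f) [RHS](@big_cat_nat _ _ _ j) ?(ltnW jF) //=.
  rewrite [X in X + _]big_nat_cond [X in X + _]big1 ?add0r // => i.
  by rewrite andbT => /bin_small ij; rewrite /f ij mul0r scale0r.
by rewrite /u kjF eqn0Ngt k0 scale0r subr0.
Qed.

Lemma additive_coef (v : nat -> V) :
  {morph (fun x => \sum_(i < #|F|) x ^+ i *: v i) : x y / x + y} ->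
  forall m, (m < #|F|)%N -> v m != 0 -> exists e, m = (p ^ e)%N.
Proof.
move=> vD m mF; have pp := pcharf_prime cp.
have [->|m0] := posnP m.
  have z : 0 ^+ 0 *: v 0%N = 0.
    have := vD 0 0; rewrite addr0 => /eqP; rewrite -subr_eq0 opprD addNKr oppr_eq0 => /eqP.
    have F0 : (0 < #|F|)%N := leq_ltn_trans (leq0n _) mF.
    rewrite (bigD1 (Ordinal F0)) //= big1 ?addr0 // => -[[|i] iF] // _.
    by rewrite exprS mul0r scale0r.
  by rewrite expr0 scale1r in z; rewrite z eqxx.
(* If m = p^e r with r > 1 prime to p, then 'C(m, p^e) is nonzero in F. *)
have [r pr mE] := pfactor_coprime pp m0; move: (logn p m) mE => e mE.
have [r1|r1 vm] := eqVneq r 1%N; first by exists e; rewrite mE r1 mul1n.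
have r0 : (0 < r)%N by case: r mE {pr r1} => // mE; rewrite mE in m0.
have pe : (0 < p ^ e)%N by rewrite expn_gt0 prime_gt0.
have mE' : m = ((r.-1 * p ^ e) + p ^ e)%N by rewrite -mulSnr prednK.
have := additive_bin_coef vD (j := p ^ e) (k := r.-1 * p ^ e) pe.
rewrite -mE' muln_gt0 pe andbT -subn1 subn_gt0 ltn_neqAle eq_sym r1 r0 => /(_ isT mF)/eqP.
have -> : 'C(m, p ^ e)%:R = r%:R :> F by rewrite mE mulnC bin_pchar_mul.
by rewrite scaler_eq0 (negPf vm) orbF -(dvdn_pcharf cp) -[(_ %| _)%N]negbK -prime_coprime // pr.
Qed.

(** The absolute trace to the prime field when [#|F|] is [p ^ n]. *)
Definition ftrace n (x : F) := \sum_(i < n) x ^+ (p ^ i).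

Lemma exprp_sum (I : finType) (f : I -> F) : (\sum_i f i) ^+ p = \sum_i f i ^+ p.
Proof.
by rewrite -(pFrobenius_autE cp) raddf_sum.
Qed.

(** The [p] distinct elements [k%:R] with [k < p] already exhaust the roots of [X^p - X]. *)
Lemma exprp_fixed (x : F) : x ^+ p = x -> exists k, x = k%:R.
Proof.
move=> xp; have pp := pcharf_prime cp; have p1 := prime_gt1 pp.
have [/hasP[k _ /eqP ->]|/hasPn h] := boolP (has (fun k => x == k%:R) (iota 0 p));
  first by exists k.
have P0 : 'X^p - 'X != 0 :> {poly F}.
  by rewrite -size_poly_eq0 size_polyDl ?size_polyXn // size_polyN size_polyX.
have := max_poly_roots (rs := x :: [seq k%:R | k <- iota 0 p]) P0.
rewrite size_polyDl ?size_polyXn ?size_polyN ?size_polyX //= size_map size_iota ltnn => H.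
suff: false by []. apply: H.
  rewrite /= rootE !hornerE xp subrr eqxx; apply/allP => _ /mapP[k _ ->].
  by rewrite rootE !hornerE -(pFrobenius_autE cp) rmorph_nat subrr.
apply/andP; split; first by apply/mapP=> -[k kp /eqP]; apply/negP; apply: h.
rewrite map_inj_in_uniq ?iota_uniq // => a b; rewrite !mem_iota !add0n /= => ap bp.
wlog ab : a b ap bp / (a <= b)%N.
  by move=> H'; case/orP: (leq_total a b) => ab e; [|symmetry]; apply: H' => //.
move/eqP; rewrite eq_sym -subr_eq0 -natrB // -(dvdn_pcharf cp) => d.
apply/eqP; rewrite eqn_leq ab -subn_eq0; apply: contraLR d; rewrite -lt0n => d0.
by rewrite gtnNdvd // (leq_ltn_trans (leq_subr _ _)).
Qed.

(** Frobenius permutes the terms of the trace cyclically, because [x ^+ (p ^ n) = x]. *)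
Lemma ftrace_natr n x : #|F| = (p ^ n)%N -> exists k, ftrace n x = k%:R.
Proof.
move=> qE; apply: exprp_fixed; rewrite exprp_sum.
under eq_bigr do rewrite -exprM -expnSr.
case: n qE => [|n] qE; first by have := finNzRing_gt1 F; rewrite qE.
by rewrite /ftrace big_ord_recr [RHS]big_ord_recl /= -qE expf_card expn0 expr1 addrC.
Qed.

End AdditiveFunctions.

(* Two sums of two powers lie within [2, 2 p^(n-1)], so they differ by less than p^n - 1. *)
Lemma exp_sum_mod_eq p n i j l : (1 < p)%N -> (i < n)%N -> (j < n)%N -> (l < n)%N ->
  j != l -> (p ^ j + p ^ i = p ^ l + 1 %[mod (p ^ n).-1])%N -> j = 0%N /\ i = l.
Proof.
case: n => // n p1 iN jN lN jl.
have pn k : (k < n.+1 -> p ^ k <= p ^ n)%N by move=> kn; rewrite leq_exp2l.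
have pk k : (0 < p ^ k)%N by rewrite expn_gt0 ltnW.
have := pn _ iN; have := pn _ jN; have := pn _ lN => hl hj hi hmod.
have h2 : (2 * p ^ n <= p ^ n.+1)%N by rewrite expnS leq_mul2r p1 orbT.
have E : (p ^ j + p ^ i = p ^ l + 1)%N.
  have [|ij] := leqP (p ^ l + 1) (p ^ j + p ^ i); last first.
    have := pk i; have := pk j; have := pk l; have := pk n => *.
    move/esym/eqP: hmod; rewrite eqn_mod_dvd ?(ltnW ij) // => /dvdn_leq; lia.
  have := pk i; have := pk j; have := pk l; have := pk n => *.
  by move/eqP: hmod; rewrite eqn_mod_dvd // => /dvdn_leq; lia.
have inj a b : (p ^ a = p ^ b -> a = b)%N by move=> /eqP; rewrite eqn_exp2l // => /eqP.
case: j jl jN hj hmod E => [|j] jl _ _ _ E; first by split=> //; apply: inj; lia.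
case: i iN hi E => [|i] _ _ E.
  have /inj e : (p ^ j.+1 = p ^ l)%N by move: E; rewrite expn0; lia.
  by rewrite e eqxx in jl.
case: l lN hl jl E => [|l] _ _ jl; rewrite !expnS.
  by rewrite expn0; have := pk j; have := pk i; nia.
move/(congr1 (modn^~ p)); rewrite -mulnDr modnMr mulnC modnMDl modn_small //.
Qed.

(** * Functions whose difference quotients lie in a subgroup without lines *)

Section DifferenceQuotients.

Variables (F : finFieldType) (V : lmodType F) (A : V -> Prop).
Hypothesis A_sub : forall u v, A u -> A v -> A (u - v).
Hypothesis A0 : A 0.
Hypothesis A_line : forall v, (forall c, A (c *: v)) -> v = 0.

(** [A] is closed under integer multiples only, so the weights must lie in the prime field; traces
    do, while [c] still ranges over all of [F]. *)
Lemma additive_quotient_linear (f : F -> V) : {morph f : x y / x + y} ->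
  (forall x, A (x^-1 *: f x)) -> forall x, f x = x *: f 1.
Proof.
move=> fD fA; have [p pp cp] := finPcharP F.
have AN v : A v -> A (- v) by rewrite -sub0r; apply: A_sub.
have AD u v : A u -> A v -> A (u + v) by move=> Au Av; rewrite -[v]opprK; apply/A_sub/AN.
have An v k : A v -> A (v *+ k).
  by move=> Av; elim: k => [|k IH]; rewrite ?mulr0n // mulrS; apply: AD.
have [n qE] : exists n, #|F| = (p ^ n)%N.
  by exists (logn p #|F|); rewrite -(card_pprimeChar cp).
have [v fv] := polyfun_card f.
have vD : {morph (fun x => \sum_(i < #|F|) x ^+ i *: v i) : x y / x + y}.
  by move=> x y; rewrite -!fv.
have vk k : (0 < k < n)%N -> v (p ^ k)%N = 0.
  case/andP=> k0 kn; apply: A_line => c; rewrite -[_ *: _]opprK; apply: AN.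
  (* u^(p^(j+k)) depends only on j + k modulo n. *)
  pose l j := ((j + k) %% n)%N.
  (* The sign comes from the surviving term, where 1 summed over the nonzero [u] gives -1. *)
  suff -> : - (c *: v (p ^ k)%N) =
      \sum_(u | u != 0) ftrace p n (c * (u / u ^+ (p ^ k))) *: (u^-1 *: f u).
    elim/big_ind: _ => // u _.
    by have [m ->] := ftrace_natr cp (c * (u / u ^+ (p ^ k))) qE; rewrite scaler_nat; apply: An.
  have lE (u : F) j : u ^+ (p ^ (j + k)) = u ^+ (p ^ l j).
    rewrite {1}(divn_eq (j + k) n) expnD mulnC exprM.
    elim: ((j + k) %/ n)%N => [|a IH]; first by rewrite expn0.
    by rewrite mulSn expnD mulnC exprM IH -qE expf_card.
  have uE (u : F) : u != 0 -> ftrace p n (c * (u / u ^+ (p ^ k))) *: (u^-1 *: f u) =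
      \sum_(j < n) \sum_(m < #|F|) (c ^+ (p ^ j) * (u ^+ (p ^ j + m) / u ^+ (p ^ l j + 1))) *: v m.
    move=> u0; rewrite /ftrace scaler_suml; apply: eq_bigr => j _.
    rewrite fv !scaler_sumr; apply: eq_bigr => m _; rewrite !scalerA; congr (_ *: _).
    rewrite !exprMn exprVn -exprM -expnD [(k + j)%N]addnC lE !exprD expr1 invfM.
    by rewrite -!mulrA [RHS]mulrA -!mulrA; do 2!congr (_ * _); rewrite [RHS]mulrCA;
      congr (_ * _); apply: mulrC.
  rewrite (eq_bigr _ uE) exchange_big /=.
  have n0 : (0 < n)%N by apply: leq_ltn_trans kn.
  have kF : (p ^ k < #|F|)%N by rewrite qE ltn_exp2l // prime_gt1.
  (* Only powers [m = p^i] carry a nonzero [v m]. As [0 < k < n], [l j] differs from [j], so the two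
     exponents agree modulo [N] only for [j = 0] and [i = k]. *)
  have jmE (j : 'I_n) (m : 'I_#|F|) : ~~ ((j == 0 :> nat) && (m == p ^ k :> nat)%N) ->
      \sum_(u : F | u != 0) (c ^+ (p ^ j) * (u ^+ (p ^ j + m) / u ^+ (p ^ l j + 1))) *: v m = 0.
    move=> jm; have [->|vm] := eqVneq (v m) 0; first by rewrite big1 // => u _; rewrite scaler0.
    have [i mE] := additive_coef cp vD (ltn_ord m) vm.
    rewrite -scaler_suml -mulr_sumr sum_expf_eq0 ?mulr0 ?scale0r // mE qE.
    apply: contra jm => /eqP /exp_sum_mod_eq -[].
    - exact: prime_gt1.
    - by have := ltn_ord m; rewrite mE qE ltn_exp2l // prime_gt1.
    - by [].
    - by rewrite ltn_mod.
    - apply/eqP=> /(congr1 (fun x => x + (n - j))%N) /(congr1 (modn^~ n)).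
      rewrite /l modnDml subnKC ?(ltnW (ltn_ord j)) // addnAC subnKC ?(ltnW (ltn_ord j)) //.
      by rewrite modnn modnDl modn_small // => /esym/eqP; rewrite eqn0Ngt k0.
    - by move=> j0 il; rewrite mE il /l j0 add0n modn_small // !eqxx.
  rewrite (bigD1 (Ordinal n0)) //= exchange_big /= (bigD1 (Ordinal kF)) //=.
  rewrite [X in _ + X + _]big1 => [|m mk]; last first.
    by apply: (jmE (Ordinal n0) m); rewrite -val_eqE in mk.
  rewrite [X in _ + _ + X]big1 => [|j j0]; last first.
    by rewrite exchange_big big1 //= => m _; apply: jmE; rewrite -val_eqE /= in j0; rewrite (negPf j0).
  rewrite !addr0 expn0 expr1 -scaler_suml -mulr_sumr.
  under eq_bigr => u u0.
    rewrite /l add0n modn_small // addnC divff ?expf_neq0 //; over.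
  by rewrite sum_nz_1 mulrN1 scaleNr.
have F1 := finNzRing_gt1 F.
have fE x : f x = x *: v 1%N.
  rewrite fv (bigD1 (Ordinal F1)) //= expr1 big1 ?addr0 // => m m1.
  have [->|vm] := eqVneq (v m) 0; first by rewrite scaler0.
  have [i mE] := additive_coef cp vD (ltn_ord m) vm.
  case: i mE => [|i] mE; first by rewrite -val_eqE /= mE eqxx in m1.
  rewrite mE vk ?scaler0 //=; have := ltn_ord m.
  by rewrite mE qE ltn_exp2l // prime_gt1.
by move=> x; rewrite fE [f 1]fE scale1r.
Qed.

Lemma quotient_affine (f : F -> V) :
  (forall x y, A ((x - y)^-1 *: (f x - f y))) -> forall x, f x = f 0 + x *: (f 1 - f 0).
Proof.
move: (polyfun_card f); move: #|F| => d; elim: d f => [|d IH] f fd fA.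
  have [v fv] := fd; move=> x; have f0 y : f y = 0 by rewrite fv big_ord0.
  by rewrite !f0 subrr scaler0 addr0.
have f_shift t x : f (x + t) - f x = f t - f 0.
  have [->|t0] := eqVneq t 0; first by rewrite addr0 !subrr.
  pose g x := f (x + t) - f x.
  have gA y z : A ((y - z)^-1 *: (g y - g z)).
    have -> : g y - g z = (f (y + t) - f (z + t)) - (f y - f z).
      by rewrite /g opprD addrACA -opprD.
    by rewrite scalerBr; apply: A_sub => //; have := fA (y + t) (z + t);
      rewrite opprD addrACA subrr addr0.
  have gE := IH g (polyfun_shift t fd) gA.
  have gt y : A (t^-1 *: g y) by have := fA (y + t) y; rewrite addrAC subrr add0r.
  (* Since [g] is affine, its increment from 0 to [t * c], divided by [t], is [c] times the slope:
     the slope spans a line in [A]. *)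
  have a0 : g 1 - g 0 = 0.
    apply: A_line => c; have := A_sub (gt (t * c)) (gt 0).
    by rewrite -scalerBr gE addrAC subrr add0r scalerA mulKf.
  by rewrite -/(g x) gE a0 scaler0 addr0 /g add0r.
have /additive_quotient_linear h : {morph (fun x => f x - f 0) : x y / x + y}.
  by move=> x y; rewrite -(f_shift y x) addrCA [f x - _]addrC addrK.
move=> x; rewrite addrC -[LHS](subrK (f 0)); congr (_ + _); apply: h => y.
by have := fA y 0; rewrite subr0.
Qed.

End DifferenceQuotients.

(** * Automorphisms of cyclotomic schemes *)

(** A nonunit generates a proper ideal; by finiteness this lies in a maximal one, which must be
    [M]. *)
Lemma local_nonrad_unit (R : finComUnitRingType) (M : {set R}) x :
  local_with_rad M -> x \notin M -> x \is a GRing.unit.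
Proof.
move=> [[_ _] Muniq] xM.
pose idealb (N : {set R}) := [&& 0 \in N,
  [forall a, forall b, (a \in N) ==> (b \in N) ==> (a + b \in N)]
  & [forall a, forall b, (b \in N) ==> (a * b \in N)]].
have idealP N : reflect (is_ideal N) (idealb N).
  apply: (iffP and3P) => [[N0 /'forall_forallP ND /'forall_forallP NM]|[N0 [ND NM]]].
    split=> //; split=> [a b aN bN|a b bN].
      by have := ND a b; rewrite aN bN.
    by have := NM a b; rewrite bN.
  split=> //; apply/'forall_forallP => a b; first by apply/implyP=> aN; apply/implyP; apply: ND.
  by apply/implyP; apply: NM.
pose P N := idealb N && (1 \notin N).
apply: contraNT xM => xU.
have Px : P [set a * x | a in [set: R]].
  apply/andP; split; last first.
    by apply: contra xU => /imsetP[a _ e]; apply/unitrPr; exists a; rewrite mulrC.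
  apply/idealP; split; first by apply/imsetP; exists 0; rewrite ?inE ?mul0r.
  split=> [_ _ /imsetP[a _ ->] /imsetP[b _ ->]|r _ /imsetP[a _ ->]].
    by apply/imsetP; exists (a + b); rewrite ?inE ?mulrDl.
  by apply/imsetP; exists (r * a); rewrite ?inE ?mulrA.
have [N /maxsetP[/andP[/idealP NI N1] Nmax] xN] := maxset_exists Px.
suff <- : N = M by apply: (subsetP xN); apply/imsetP; exists 1; rewrite ?inE ?mul1r.
apply: Muniq; split=> //; split=> [|N' N'I NN'].
  by apply: contraNneq N1 => ->; rewrite inE.
have [N'1|N'1] := boolP (1 \in N'); last first.
  by left; apply: Nmax => //; apply/andP; split=> //; apply/idealP.
by right; apply/setP=> y; rewrite inE -[y]mulr1; have [_ [_ ->]] := N'I.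
Qed.

(** For permutations and a subgroup [K] this amounts to [cyc_aut]; plain functions make composites
    and affine twists easy to form. *)
Definition cyc_map (R : finComUnitRingType) (K : {set R}) (f : R -> R) :=
  forall x y, exists2 k, k \in K & f y - f x = (y - x) * k.

(** Stated for sets so as to cover both [unit_elems K] and its image under [pi0]. *)
Definition unit_subgroup (R : finComUnitRingType) (K : {set R}) :=
  [/\ 1 \in K, {in K &, forall x y, x * y \in K} &
      {in K, forall x, x \is a GRing.unit /\ x^-1 \in K}].

Lemma unit_elems_subgroup (R : finComUnitRingType) (K : {group {unit R}}) :
  unit_subgroup (unit_elems K).
Proof.
split=> [|_ _ /imsetP[k kK ->] /imsetP[l lK ->]|_ /imsetP[k kK ->]].
- by apply/imsetP; exists 1%g; rewrite ?group1.
- by apply/imsetP; exists (k * l)%g; rewrite ?groupM.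
- split; first exact: valP.
  by apply/imsetP; exists k^-1%g; rewrite ?groupV.
Qed.

Lemma rmorph_unit_subgroup (R S : finComUnitRingType) (f : {rmorphism R -> S}) (K : {set R}) :
  unit_subgroup K -> unit_subgroup [set f x | x in K].
Proof.
move=> [K1 KM KV]; split=> [|_ _ /imsetP[k kK ->] /imsetP[l lK ->]|_ /imsetP[k kK ->]].
- by apply/imsetP; exists 1; rewrite ?rmorph1.
- by apply/imsetP; exists (k * l); rewrite ?rmorphM ?KM.
- have [kU kV] := KV k kK; split; first exact: rmorph_unit.
  by apply/imsetP; exists k^-1; rewrite ?rmorphV.
Qed.

Section CyclotomicMaps.

Variables (R : finComUnitRingType) (K : {set R}).
Hypothesis Kgrp : unit_subgroup K.

Lemma cyc_aut_map (f : {perm R}) : cyc_aut K f -> cyc_map K f.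
Proof.
case: Kgrp => K1 _ _ fK x y.
have : cyc_rel K (y - x) x y by apply/exists_inP; exists 1; rewrite ?mulr1.
by rewrite -fK => /exists_inP[k kK /eqP]; exists k.
Qed.

Lemma cyc_map_aut (f : {perm R}) : cyc_map K f -> cyc_aut K f.
Proof.
case: Kgrp => K1 KM KV fK r x y; have [k kK fE] := fK x y; have [kU kV] := KV k kK.
apply/exists_inP/exists_inP=> -[l lK /eqP e]; last first.
  by exists (l * k); rewrite ?KM // fE e mulrA.
exists (l * k^-1); rewrite ?KM // mulrA -e fE mulrK //.
Qed.

Lemma cyc_map_inj f : cyc_map K f -> injective f.
Proof.
case: Kgrp => K1 KM KV fK x y e; have [k kK fE] := fK y x; have [kU _] := KV k kK.
by apply/eqP; rewrite -subr_eq0 -(mulIr_eq0 _ (mulIr kU)) -fE e subrr.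
Qed.

Lemma cyc_map_inv f g : cancel g f -> cyc_map K f -> cyc_map K g.
Proof.
case: Kgrp => K1 KM KV fK fP x y; have [k kK fE] := fP (g x) (g y); have [kU kV] := KV k kK.
by exists k^-1 => //; rewrite -[y in RHS]fK -[x in RHS]fK fE mulrK.
Qed.

Lemma cyc_map_comp f g : cyc_map K f -> cyc_map K g -> cyc_map K (f \o g).
Proof.
case: Kgrp => K1 KM KV fP gP x y; have [k kK fE] := fP (g x) (g y); have [l lK gE] := gP x y.
by exists (l * k); rewrite ?KM //= fE gE mulrA.
Qed.

(** Only the product [w * r] has to lie in [K], which permits the twist [f (r * x) / f r] for any
    unit [r]. *)
Lemma cyc_map_affine f w r s c : w * r \in K -> cyc_map K f ->
  cyc_map K (fun x => w * f (r * x + s) + c).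
Proof.
case: Kgrp => K1 KM KV wrK fP x y; have [k kK fE] := fP (r * x + s) (r * y + s).
exists (w * r * k); first exact: KM.
transitivity (w * (f (r * y + s) - f (r * x + s))); first by ring.
by rewrite fE; ring.
Qed.

End CyclotomicMaps.

(** * Rigidity of maps that are trivial modulo the annihilator of the radical *)

Lemma residually_trivial_cyc_map (R : finComUnitRingType) (M : {set R})
  (K : {group {unit R}}) (g : R -> R) :
  local_with_rad M -> pure K -> cyc_map (unit_elems K) g -> g 0 = 0 -> g 1 = 1 ->
  (forall x, g x - x \in M /\ forall y, y \in M -> (g x - x) * y = 0) ->
  g =1 id.
Proof.
move=> locM pureK gK g0 g1 gM; have [[MI [MT _]] _] := locM.
have MU x : x \notin M -> x \is a GRing.unit by apply: local_nonrad_unit.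
have M1 : 1 \notin M.
  apply: contraNN MT => M1; apply/eqP/setP=> x; rewrite inE -[x]mulr1.
  by have [_ [_ ->]] := MI.
have [F [p [psurj pM]]] := residue_field MI MU M1.
have [V [i [iinj iZ iAnn]]] := annihilator_module psurj.
have [K1 KM KV] := unit_elems_subgroup K.
have [M0 [MD MM]] := MI.
have inull m v : m \in M -> m * i v = 0 by rewrite -pM -iZ => /eqP ->; rewrite scale0r raddf0.
have [d dE] : exists d : R -> V, forall x, i (d x) = g x - x.
  have h x : exists v, i v = g x - x.
    by apply: iAnn => m /eqP; rewrite pM => mM; have [_ ->] := gM x.
  by have [d dE] := fin_all_exists h; exists d.
(* [V] is the whole annihilator of [M], which is [R] when [M] is zero; membership in [M] cuts it
   down to [I_0]. *)
pose A v := i v \in M /\ 1 + i v \in unit_elems K.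
have A0 : A 0 by rewrite /A raddf0 addr0.
have A_sub u v : A u -> A v -> A (u - v).
  move=> [uM uK] [vM vK]; split; first by rewrite raddfB /= -mulN1r; apply/MD/MM.
  have [vU vV] := KV _ vK.
  (* Products of two such elements vanish, so division in [K] becomes subtraction in [A]. *)
  have -> : 1 + i (u - v) = (1 + i u) * (1 + i v)^-1; last exact: KM.
  rewrite -[LHS](mulrK vU) raddfB /=; congr (_ * _).
  rewrite mulrDr mulr1 mulrDl mul1r mulrBl (inull _ _ uM) (inull _ _ vM) subrr addr0.
  by rewrite -!addrA addNr addr0.
(* A line through [v] is the ideal generated by [i v], to which purity applies. *)
have A_line v : (forall c, A (c *: v)) -> v = 0.
  move=> Av; apply: iinj; rewrite raddf0; apply/set1P.
  have <- : [set r * i v | r in [set: R]] = [set 0].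
    apply: pureK; last by move=> _ /imsetP[r _ ->]; rewrite -iZ; case: (Av (p r)).
    split; first by apply/imsetP; exists 0; rewrite ?inE ?mul0r.
    split=> [_ _ /imsetP[a _ ->] /imsetP[b _ ->]|r _ /imsetP[a _ ->]].
      by apply/imsetP; exists (a + b); rewrite ?inE ?mulrDl.
    by apply/imsetP; exists (r * a); rewrite ?inE ?mulrA.
  by apply/imsetP; exists 1; rewrite ?inE ?mul1r.
(* Here [x - y] is a unit, and [(g x - g y) / (x - y)] is 1 plus the difference quotient of [d]. *)
have Ad x y : p x != p y -> A ((p x - p y)^-1 *: (d x - d y)).
  rewrite -subr_eq0 -rmorphB pM => /MU xyU.
  rewrite /A -rmorphV // iZ raddfB /= !dE; split.
    apply: (MM); apply: MD; first by have [] := gM x.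
    by rewrite -mulN1r; apply: MM; have [] := gM y.
  have [k kK gE] := gK y x.
  suff -> : 1 + (x - y)^-1 * (g x - x - (g y - y)) = k by [].
  by apply: (mulrI xyU); rewrite mulrDr mulVKr // -gE; ring.
have d_class x y : p x = p y -> d x = d y.
  move=> xy; apply/eqP; rewrite -subr_eq0; apply/eqP/A_line => c.
  have [->|c0] := eqVneq c 0; first by rewrite scale0r.
  (* Both [x] and [y] are compared with the point [y - u], at residue distance [c^-1]; subtracting
     puts [c *: (d x - d y)] in [A]. *)
  have [u uE] := psurj c^-1; have h z : p z = p y -> A (c *: (d z - d (y - u))).
    move=> zy; have e : p z - p (y - u) = c^-1 by rewrite rmorphB uE zy opprB addrC subrK.
    by have := @Ad z (y - u); rewrite -subr_eq0 e invrK; apply; apply: invr_neq0.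
  have := A_sub _ _ (h x xy) (h y erefl); rewrite -scalerBr; congr (A (c *: _)).
  by rewrite opprB addrA subrK.
have [l lK] := fin_all_exists psurj.
have d0 x : g x = x -> d x = 0 by move=> e; apply: iinj; rewrite dE e subrr raddf0.
have dl x : d (l (p x)) = d x by apply: d_class; rewrite lK.
have /(quotient_affine A_sub A0 A_line) dlE : forall a b, A ((a - b)^-1 *: (d (l a) - d (l b))).
  move=> a b; have [->|ab] := eqVneq a b; first by rewrite !subrr scaler0.
  by have := @Ad (l a) (l b); rewrite !lK; apply.
have dl0 : d (l 0) = 0 by rewrite -(rmorph0 p) dl d0.
have dl1 : d (l 1) = 0 by rewrite -(rmorph1 p) dl d0.
move=> x; apply/eqP; rewrite -subr_eq0 -dE -dl dlE dl0 dl1.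
by rewrite subrr scaler0 addr0 raddf0.
Qed.

(** * Normalized automorphisms are ring automorphisms *)

Section NormalizedMaps.

Variables (R : finComUnitRingType) (M : {set R}) (K : {group {unit R}}).
Variables (S : finComUnitRingType) (pi0 : {rmorphism R -> S}).
Hypotheses (locM : local_with_rad M) (pureK : pure K).
Hypothesis pi0_surj : forall y, exists x, pi0 x = y.
Hypothesis pi0_ker :
  forall x, pi0 x = 0 <-> (x \in M /\ forall y, y \in M -> x * y = 0).
Hypothesis normal_S : cyc_normal [set pi0 x | x in unit_elems K].
Local Notation KR := (unit_elems K).

(** Rigidity is applied to the inverse of [f] after [h]: it moves [x] by a multiple of [h x - f x],
    hence within the kernel of [pi0]. *)
Lemma cyc_map_unique f h : cyc_map KR f -> cyc_map KR h ->
  f 0 = 0 -> h 0 = 0 -> f 1 = 1 -> h 1 = 1 -> (forall x, pi0 (f x) = pi0 (h x)) -> f =1 h.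
Proof.
move=> fK hK f0 h0 f1 h1 fh; have Kgrp := unit_elems_subgroup K.
have [g fg gf] : bijective f := injF_bij (cyc_map_inj Kgrp fK).
have gK := cyc_map_inv Kgrp gf fK.
have gh : g \o h =1 id.
  apply: (residually_trivial_cyc_map locM pureK (cyc_map_comp Kgrp gK hK)) => [||x] /=.
  - by rewrite h0 -f0 fg.
  - by rewrite h1 -f1 fg.
  apply/pi0_ker; have [k _ e] := gK (f x) (h x).
  by rewrite -[x in _ - x]fg e rmorphM rmorphB fh subrr mul0r.
by move=> x; rewrite -[in LHS](gh x) /= gf.
Qed.

(** Increments of [f] are multiples of those of the argument, so [f] descends to [S]. There it is
    semiaffine by normality, and the values at 0 and 1 force [a = 1] and [b = 0]. *)
Lemma cyc_map_residual f : cyc_map KR f -> f 0 = 0 -> f 1 = 1 ->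
  (forall x y, pi0 (f (x + y)) = pi0 (f x + f y)) /\
  (forall x y, pi0 (f (x * y)) = pi0 (f x * f y)).
Proof.
move=> fK f0 f1; have Kgrp := unit_elems_subgroup K.
have SKgrp := rmorph_unit_subgroup pi0 Kgrp.
have [l lK] := fin_all_exists pi0_surj.
pose fS y := pi0 (f (l y)).
have fSE x : fS (pi0 x) = pi0 (f x).
  apply/eqP; rewrite -subr_eq0 -rmorphB; have [k _ ->] := fK x (l (pi0 x)).
  by rewrite rmorphM rmorphB lK subrr mul0r.
have fSK : cyc_map [set pi0 x | x in KR] fS.
  move=> x y; have [k kK e] := fK (l x) (l y); exists (pi0 k); first exact: imset_f.
  by rewrite -rmorphB e rmorphM rmorphB !lK.
pose fP := perm (cyc_map_inj SKgrp fSK).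
have fPK : cyc_map [set pi0 x | x in KR] fP by move=> x y; rewrite !permE; apply: fSK.
have [a [b [s [_ [_ s1 sD sM] abE]]]] := normal_S (cyc_map_aut SKgrp fPK).
have s0 : s 0 = 0 by apply: (addrI (s 0)); rewrite -sD !addr0.
have b0 : b = 0 by have := abE 0; rewrite permE -(rmorph0 pi0) fSE f0 !rmorph0 s0 mulr0 add0r.
have a1 : a = 1 by have := abE 1; rewrite permE -(rmorph1 pi0) fSE f1 !rmorph1 s1 b0 addr0 mulr1.
have fs x : pi0 (f x) = s (pi0 x).
  by rewrite -fSE; have := abE (pi0 x); rewrite permE a1 b0 mul1r addr0.
by split=> x y; rewrite ?rmorphD ?rmorphM !fs ?rmorphD ?rmorphM ?sD ?sM.
Qed.

Lemma normalized_cyc_map_ring_aut f :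
  cyc_map KR f -> f 0 = 0 -> f 1 = 1 -> ring_aut f.
Proof.
move=> fK f0 f1; have Kgrp := unit_elems_subgroup K; have [K1 KM KV] := Kgrp.
have [piD piM] := cyc_map_residual fK f0 f1.
have [g fg gf] : bijective f := injF_bij (cyc_map_inj Kgrp fK).
have fM_unit x r : r \is a GRing.unit -> f (r * x) = f r * f x.
  move=> rU; have [k kK fr] := fK 0 r; have [kU kV] := KV k kK.
  rewrite f0 !subr0 in fr; have frU : f r \is a GRing.unit by rewrite fr unitrM rU.
  have wK : (f r)^-1 * r \in KR by rewrite fr invrM // mulrVK.
  have hK := cyc_map_affine Kgrp 0 0 wK fK.
  have <- : (f r)^-1 * f (r * x + 0) + 0 = f x.
    apply: (cyc_map_unique hK fK) => [||||z] //.
    - by rewrite mulr0 !addr0 f0 mulr0.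
    - by rewrite mulr1 !addr0 mulVr.
    by rewrite !addr0 rmorphM piM -rmorphM mulKr.
  by rewrite !addr0 mulVKr.
have /fin_all_exists[a aP] r : exists a, [/\ forall x, f (x + r) = f r + (1 + a) * f x,
    1 + a \in KR & pi0 a = 0].
  have [k kK kE] := fK r (1 + r); rewrite addrK mul1r in kE.
  have [kU kV] := KV k kK.
  have pik : pi0 k = 1 by rewrite -kE rmorphB piD rmorphD addrK f1 rmorph1.
  have kE1 : 1 + (k - 1) = k by rewrite addrC subrK.
  exists (k - 1); rewrite kE1; split=> [x||] //; last by rewrite rmorphB pik rmorph1 subrr.
  have wK : k^-1 * 1 \in KR by rewrite mulr1.
  have hK := cyc_map_affine Kgrp r (- (k^-1 * f r)) wK fK.
  have <- : k^-1 * f (1 * x + r) - k^-1 * f r = f x.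
    apply: (cyc_map_unique hK fK) => [||||z] //.
    - by rewrite mulr0 add0r subrr.
    - by rewrite mulr1 -mulrBr kE mulVr.
    by rewrite mul1r -mulrBr rmorphM rmorphV // pik invr1 mul1r rmorphB piD rmorphD addrK.
  by rewrite mul1r -mulrBr mulVKr // [RHS]addrC subrK.
(* [f (x + 1)] is expanded in two ways, with shift 1 and with shift [x]. *)
have a_sym x : a 1 * f x = a x.
  have [aE1 _ _] := aP 1; have [aEx _ _] := aP x.
  have := aE1 x; rewrite addrC aEx f1 mulr1 !mulrDl mul1r addrA => /eqP.
  by rewrite [f x + 1]addrC -!addrA !(inj_eq (addrI _)) eq_sym => /eqP.
have a1 : a 1 = 0.
  apply/set1P; have <- : [set y * a 1 | y in [set: R]] = [set 0].
    apply: pureK; last first.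
      (* By surjectivity of [f], every multiple of [a 1] is some [a x], and [1 + a x] is in [K]. *)
      by move=> _ /imsetP[y _ ->]; rewrite -[y]gf mulrC a_sym; case: (aP (g y)).
    split; first by apply/imsetP; exists 0; rewrite ?inE ?mul0r.
    split=> [_ _ /imsetP[y _ ->] /imsetP[z _ ->]|r _ /imsetP[y _ ->]].
      by apply/imsetP; exists (y + z); rewrite ?inE ?mulrDl.
    by apply/imsetP; exists (r * y); rewrite ?inE ?mulrA.
  by apply/imsetP; exists 1; rewrite ?inE ?mul1r.
have fD x y : f (x + y) = f x + f y.
  by have [-> _ _] := aP y; rewrite -a_sym a1 mul0r addr0 mul1r addrC.
split=> // [|x y]; first by exists g.
(* For [x] in [M] the element [1 + x] is a unit; additivity then removes the 1. *)
have [xM|/(local_nonrad_unit locM)/fM_unit->//] := boolP (x \in M).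
have [[[M0 [MD MM]] [MT _]] _] := locM.
have xU : 1 + x \is a GRing.unit.
  apply: (local_nonrad_unit locM); apply: contraNN MT => x1.
  apply/eqP/setP=> z; rewrite inE -[z]mulr1; apply: (MM).
  by rewrite -[1](addrK x) -mulN1r; apply/MD/MM.
by have := fM_unit y _ xU; rewrite mulrDl mul1r !fD f1 mulrDl mul1r => /addrI.
Qed.

End NormalizedMaps.

Theorem theorem1p8 (R : finComUnitRingType) (M : {set R})
  (K : {group {unit R}})
  (S : finComUnitRingType) (pi0 : {rmorphism R -> S}) :
  local_with_rad M ->
  pure K ->
  (* pi0 : R -> R/I_0 is the natural epimorphism, I_0 = {x in rad R | x rad R = 0} *)
  (forall y : S, exists x : R, pi0 x = y) ->
  (forall x : R, pi0 x = 0 <-> (x \in M /\ forall y, y \in M -> x * y = 0)) ->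
  cyc_normal [set pi0 x | x in unit_elems K] ->
  cyc_normal (unit_elems K).
Proof.
move=> locM pureK pi0_surj pi0_ker normal_S f fKaut.
have Kgrp := unit_elems_subgroup K; have [K1 KM KV] := Kgrp.
have fK := cyc_aut_map Kgrp fKaut.
have [k kK kE] := fK 0 1; rewrite subr0 mul1r in kE; have [kU kV] := KV k kK.
have wK : k^-1 * 1 \in unit_elems K by rewrite mulr1.
have hK := cyc_map_affine Kgrp 0 (- (k^-1 * f 0)) wK fK.
(* With [k = f 1 - f 0], the map [(f x - f 0) / k] fixes 0 and 1. *)
exists k, (f 0), (fun x => k^-1 * f (1 * x + 0) - k^-1 * f 0); split=> // [|x].
  apply: (normalized_cyc_map_ring_aut locM pureK pi0_surj pi0_ker normal_S hK).
  - by rewrite mulr0 addr0 subrr.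
  - by rewrite mulr1 addr0 -mulrBr kE mulVr.
by rewrite mul1r addr0 -mulrBr mulVKr // subrK.
Qed.
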